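(* Suppose $(\alpha,\beta)$ is $\{\pm1\}$-feasible. Then for every finite set $\mathcal{A}\subset\mathbb{R}$ the pair $(\alpha,C(\mathcal{A})\beta)$ is $\mathcal{A}$-feasible, using the same encoding scheme for all $\mathcal{A}$; that is, there is a single infinite sequence of linear encodings (not depending on $\mathcal{A}$) such that for every finite $\mathcal{A}\subset\mathbb{R}$ these encodings are the encodings of a family of $\mathcal{A}$-protocols witnessing the $\mathcal{A}$-feasibility of $(\alpha,C(\mathcal{A})\beta)$.
   Context: Protocols. Let $\mathcal{A}\subset\mathbb{R}$ be finite. An $\mathcal{A}$-protocol with parameters $(k,n,\ell)$ (positive integers, $n\ge k$) consists of a linear encoding $\mathbb{R}^k\to\mathbb{R}^n$, $\mathbf{x}\mapsto\mathbf{y}=(y_1,\dots,y_n)$ (each $y_i$ is a fixed linear combination of the entries of $\mathbf{x}$ and is stored on server $i$), together with, for every $\mathbf{w}\in\mathcal{A}^k$, a set $S_{\mathbf{w}}\subseteq[n]$ of at most $\ell$ servers (depending only on $\mathbf{w}$) and a decoding function that for every $\mathbf{x}\in\mathbb{R}^k$ computes $\mathbf{w}\mathbf{x}^\intercal$ from $(y_i)_{i\in S_{\mathbf{w}}}$. Feasibility. A pair $(\alpha,\beta)\in\mathbb{R}^2$ is $\mathcal{A}$-feasible if there is an infinite family of $\mathcal{A}$-protocols with parameters $\{(k_i,n_i,\ell_i)\}_{i\ge0}$, with $k_i$ strictly increasing, such that $\lim_{i\to\infty}(n_i/k_i,\ell_i/k_i)=(\alpha,\beta)$. Complexity. For a finite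 set $\mathcal{A}\subset\mathbb{R}$, the (additive) complexity $C(\mathcal{A})$ is the smallest positive integer $\theta$ for which there exist (not necessarily distinct) real numbers $x_1,\dots,x_\theta,y_1,\dots,y_\theta$ with $\mathcal{A}\subseteq\{x_1,y_1\}+\{x_2,y_2\}+\cdots+\{x_\theta,y_\theta\}$, where $+$ denotes the sumset $\mathcal{S}+\mathcal{T}=\{s+t\mid s\in\mathcal{S},t\in\mathcal{T}\}$. *)

(* Defs.v *)
From HB Require Import structures.
From mathcomp Require Import all_boot all_order all_algebra.
From mathcomp Require Import boolp classical_sets functions cardinality.
From mathcomp Require Import reals topology normedtype sequences.

Set Implicit Arguments.
Unset Strict Implicit.
Unset Printing Implicit Defensive.

Import Order.TTheory GRing.Theory Num.Theory.
Import numFieldNormedType.Exports.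

Local Open Scope classical_set_scope.
Local Open Scope ring_scope.

(* The fields [servers] and [decode] are total in [w]; only their values at
   [w] with entries in [A] are constrained. *)
Record protocol (R : realType) (A : set R) (k n l : nat) := Protocol {
  k_gt0 : (0 < k)%N;
  n_gt0 : (0 < n)%N;
  l_gt0 : (0 < l)%N;
  k_le_n : (k <= n)%N;
  encoding : {linear 'rV[R]_k -> 'rV[R]_n};
  servers : 'rV[R]_k -> {set 'I_n};
  decode : forall w : 'rV[R]_k, ({i : 'I_n | i \in servers w} -> R) -> R;
  card_servers : forall w : 'rV[R]_k, (forall j, A (w 0 j)) ->
    (#|servers w| <= l)%N;
  decodeP : forall w : 'rV[R]_k, (forall j, A (w 0 j)) ->
    forall x : 'rV[R]_k,
      decode (fun i : {i : 'I_n | i \in servers w} => encoding x 0 (val i))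
      = (w *m x^T) 0 0
}.

Definition witnesses (R : realType) (A : set R) (k n l : nat -> nat)
    (P : forall i, protocol A (k i) (n i) (l i)) (ab : R * R) : Prop :=
  {homo k : i j / (i < j)%N} /\
  (fun i => ((n i)%:R / (k i)%:R, (l i)%:R / (k i)%:R) : R * R) @ \oo --> ab.

Definition feasible (R : realType) (A : set R) (ab : R * R) : Prop :=
  exists (k n l : nat -> nat) (P : forall i, protocol A (k i) (n i) (l i)),
    witnesses P ab.

Definition sumset (R : realType) (S T : set R) : set R :=
  [set s + t | s in S & t in T].

Definition decomposable (R : realType) (A : set R) (theta : nat) : Prop :=
  exists x y : 'I_theta -> R,
    A `<=` \big[@sumset R/[set 0]]_(i < theta) [set x i; y i].

Definition is_complexity (R : realType) (A : set R) (theta : nat) : Prop :=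
  [/\ (0 < theta)%N, decomposable A theta &
      forall t, (0 < t)%N -> decomposable A t -> (theta <= t)%N].

(* The default value 0 is never taken on finite sets, see [complexityP]. *)
Definition complexity (R : realType) (A : set R) : nat :=
  xget 0%N [set theta | is_complexity A theta].

Lemma complexityP (R : realType) (A : set R) :
  finite_set A -> is_complexity A (complexity A).
Proof.
move=> /finite_seqP[s ->]; apply: (@xgetPex _ 0%N [set t | is_complexity _ t]).
have big_sum m (F : 'I_m -> set R) (f : 'I_m -> R) :
    (forall i, F i (f i)) ->
    (\big[@sumset R/[set 0]]_(i < m) F i) (\sum_(i < m) f i).
  by move=> Ff; elim/big_ind2: _ => // a S b T Sa Tb; exists a => //; exists b.
have ex : exists m, (0 < m)%N && `[< decomposable [set` s] m >].
  exists (size s).+1; apply/andP; split=> //; apply/asboolP.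
  exists (fun=> 0), (fun i => s`_i) => a /= sa.
  have lt_a : (index a s < (size s).+1)%N by rewrite ltnS index_size.
  have -> : a = \sum_(i < (size s).+1) if i == Ordinal lt_a then s`_i else 0.
    by rewrite -big_mkcond big_pred1_eq /= nth_index.
  by apply: big_sum => i; case: eqP => _; [right | left].
case: (ex_minnP ex) => m /andP[m_gt0 /asboolP dm] mP.
exists m; split=> // t t_gt0 dt.
by apply: mP; rewrite t_gt0; apply/asboolP.
Qed.

(* Main.v *)
(** If A is contained in {x_1, y_1} + ... + {x_theta, y_theta}, then every w with
    entries in A is c 1 + d_1 s_1 + ... + d_theta s_theta, where the s_i have
    entries +-1, d_i = (x_i - y_i) / 2 and c is the sum of the (x_i + y_i) / 2.
    Add to a {+-1}-protocol one server that stores the sum of the entries of x;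
    then w x^T is computed from that server and the theta queries s_i, so that
    (n, l) becomes (n + 1, theta l + 1). As k tends to infinity, the extra 1 is
    negligible, and the new encoding depends on A in no way. *)
Require Import Defs.
From HB Require Import structures.
From mathcomp Require Import all_boot all_order all_algebra.
From mathcomp Require Import boolp classical_sets functions cardinality.
From mathcomp Require Import reals topology normedtype sequences.
From mathcomp Require Import ring.
Import Order.TTheory GRing.Theory Num.Theory.
Import numFieldNormedType.Exports.
Local Open Scope classical_set_scope.
Local Open Scope ring_scope.

Set Implicit Arguments.
Unset Strict Implicit.
Unset Printing Implicit Defensive.

Lemma big_sumsetP (R : realType) (m : nat) (F : 'I_m -> set R) (a : R) :
  (\big[@sumset R/[set 0]]_(i < m) F i) a ->
  exists z : 'I_m -> R, (forall i, F i (z i)) /\ a = \sum_(i < m) z i.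
Proof.
elim: m F a => [|m IHm] F a.
  by rewrite big_ord0 => /= ->; exists (fun=> 0); rewrite big_ord0; split=> // -[].
rewrite big_ord_recl => -[z0 Fz0 [b /IHm[z [Fz ->]] <-]].
exists (fun i => if unlift ord0 i is Some j then z j else z0); split.
  by move=> i; case: unliftP => [j|] ->.
rewrite big_ord_recl unlift_none; congr (_ + _).
by apply: eq_bigr => i _; rewrite liftK.
Qed.

Lemma mem_pm_half (F : numFieldType) (x y z : F) : [set x; y] z ->
  exists s, [set 1; -1] s /\ z = (x + y) / 2 + (x - y) / 2 * s.
Proof.
by case=> ->; [exists 1 | exists (-1)]; (split; [by [left | right] | field]).
Qed.

Lemma decomposable_pm (R : realType) (A : set R) (theta : nat) :
  decomposable A theta ->
  exists (c : R) (d : 'I_theta -> R), forall k (w : 'rV[R]_k),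
    (forall j, A (w 0 j)) ->
    exists s : 'I_theta -> 'rV[R]_k,
      (forall i j, [set 1; -1] (s i 0 j)) /\
      w = const_mx c + \sum_i d i *: s i.
Proof.
move=> [x [y Axy]].
exists (\sum_i (x i + y i) / 2), (fun i => (x i - y i) / 2) => k w Aw.
(* Signs are chosen column by column, one for each pair [x i], [y i]; collecting those of a fixed
   [i] over all [j] gives the row [s i]. *)
have /choice[s sP] j : exists s : 'I_theta -> R,
    (forall i, [set 1; -1] (s i)) /\
    w 0 j = \sum_i (x i + y i) / 2 + \sum_i (x i - y i) / 2 * s i.
  have [z [xyz ->]] := big_sumsetP (Axy _ (Aw j)).
  have /choice[s sP] i := mem_pm_half (xyz i).
  exists s; split=> [i|]; first by have [] := sP i.
  by rewrite -big_split; apply: eq_bigr => i _; have [] := sP i.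
exists (fun i => \row_j s j i); split=> [i j|].
  by rewrite mxE; have [] := sP j.
apply/rowP => j; have [_ ->] := sP j.
by rewrite !mxE summxE; congr (_ + _); apply: eq_bigr => i _; rewrite !mxE.
Qed.

Section AddSumServer.
Variables (R : realType) (k n : nat) (E : {linear 'rV[R]_k -> 'rV[R]_n}).

Definition add_sum (x : 'rV[R]_k) : 'rV[R]_(n + 1) :=
  row_mx (E x) (x *m const_mx 1).

Fact add_sum_is_linear : linear add_sum.
Proof.
move=> a x y.
by rewrite /add_sum linearP mulmxDl -scalemxAl scale_row_mx add_row_mx.
Qed.

HB.instance Definition _ := GRing.isLinear.Build R 'rV[R]_k 'rV[R]_(n + 1) _
  add_sum add_sum_is_linear.

End AddSumServer.

(** Extension by zero lets answers indexed by a large server set be fed to a decoder that expects a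
    subset of it, with no transport of membership proofs. *)
Definition extend0 (R : nmodType) (m : nat) (S : {set 'I_m})
  (f : {i : 'I_m | i \in S} -> R) (i : 'I_m) : R := oapp f 0 (insub i).

Lemma extend0_val (R : nmodType) (m : nat) (S : {set 'I_m}) (v : 'I_m -> R) i :
  i \in S -> extend0 (fun u : {i | i \in S} => v (val u)) i = v i.
Proof. by move=> iS; rewrite /extend0 insubT. Qed.

(** The equation on encodings shows that [A] and [theta] affect only the server sets and the
    decoders. *)
Lemma protocol_of_pm (R : realType) (A : set R) (theta k n l : nat)
    (P : protocol [set 1; -1 : R] k n l) : decomposable A theta ->
  exists Q : protocol A k (n + 1) (theta * l + 1),
    encoding Q = add_sum (encoding P) :> {linear _ -> _}.
Proof.
move=> /decomposable_pm[c [d cd]].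
have /choice[s sP] (w : 'rV[R]_k) : exists s : 'I_theta -> 'rV[R]_k,
    (forall j, A (w 0 j)) ->
    (forall i j, [set 1; -1] (s i 0 j)) /\ w = const_mx c + \sum_i d i *: s i.
  have [/cd[s sP]|nAw] := pselect (forall j, A (w 0 j)); first by exists s.
  (* Junk value: a protocol constrains only those [w] with entries in [A]. *)
  by exists (fun=> 0).
pose S w : {set 'I_(n + 1)} :=
  rshift n ord0 |: \bigcup_(i < theta) lshift 1 @: servers P (s w i).
pose dec w (f : {i | i \in S w} -> R) : R :=
  c * extend0 f (rshift n ord0) +
  \sum_i d i * decode (fun u : {j | j \in servers P (s w i)} =>
                         extend0 f (lshift 1 (val u))).
have S_le (w : 'rV_k) : (forall j, A (w 0 j)) -> (#|S w| <= theta * l + 1)%N.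
  move=> /sP[pm _]; rewrite [leqRHS]addnC; apply: leq_trans (leq_card_setU _ _) _.
  rewrite cards1 leq_add2l.
  (* Writing [theta * l] as a sum over the same index as the union lets [big_ind2] prove the union
     bound. *)
  apply: leq_trans (_ : \sum_(i < theta) l <= _)%N; last first.
    by rewrite sum_nat_const card_ord.
  elim/big_ind2: _ => [|B b D e Bb De|i _]; first by rewrite cards0.
    exact: leq_trans (leq_card_setU _ _) (leq_add Bb De).
  by apply: leq_trans (leq_imset_card _ _) _; apply: card_servers; apply: pm.
have decP (w : 'rV_k) : (forall j, A (w 0 j)) -> forall x : 'rV[R]_k,
    dec w (fun i => add_sum (encoding P) x 0 (val i)) = (w *m x^T) 0 0.
  move=> /sP[pm wE] x; rewrite [in RHS]wE /dec.
  rewrite (extend0_val (add_sum (encoding P) x 0)) ?setU11// row_mxEr.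
  rewrite mulmxDl mulmx_suml [RHS]mxE summxE; congr (_ + _).
    rewrite !mxE mulr_sumr; apply: eq_bigr => j _.
    by rewrite !mxE mulr1.
  apply: eq_bigr => i _; rewrite -scalemxAl [RHS]mxE -(decodeP P (pm i)).
  (* The servers of the query [s w i] lie in [S w] after [lshift], so the decoder of [P] receives
     the true stored values and never the default 0. *)
  congr (_ * decode _); apply: funext => -[j jS] /=.
  rewrite (extend0_val (add_sum (encoding P) x 0)) ?row_mxEl//.
  by apply/setU1P; right; apply/bigcupP; exists i => //; apply: imset_f.
have n1_gt0 : (0 < n + 1)%N by rewrite addn1.
have l1_gt0 : (0 < theta * l + 1)%N by rewrite addn1.
have k_le : (k <= n + 1)%N := leq_trans (k_le_n P) (leq_addr 1 n).
by exists (@Protocol R A k (n + 1) (theta * l + 1) (k_gt0 P) n1_gt0 l1_gt0 k_le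
             (add_sum (encoding P)) S dec S_le decP).
Qed.

(** The ratio is [t] times [u i / k i] plus [1 / k i], and [i < k i] squeezes the last term between
    0 and the harmonic sequence [1 / (i + 1)]. *)
Lemma cvg_affine_ratio (R : realType) (k u : nat -> nat) (t : nat) (a : R) :
  (forall i, (i < k i)%N) ->
  (fun i => (u i)%:R / (k i)%:R : R) @ \oo --> a ->
  (fun i => (t * u i + 1)%:R / (k i)%:R : R) @ \oo --> t%:R * a.
Proof.
move=> ltk cvu.
have cvk : (fun i => (k i)%:R^-1 : R) @ \oo --> (0 : R).
  apply: (squeeze_cvgr _ (cvg_cst 0) cvg_harmonic); apply: nearW => i.
  rewrite invr_ge0 ler0n /=.
  by rewrite lef_pV2 ?posrE ?ltr0n ?ler_nat// (leq_trans _ (ltk i)).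
rewrite -[t%:R * a]addr0.
under eq_fun do rewrite natrD natrM mulrDl mul1r -mulrA.
by apply: cvgD => //; apply: cvgM => //; apply: cvg_cst.
Qed.

Lemma homo_ltn_gt (k : nat -> nat) :
  (0 < k 0)%N -> {homo k : i j / (i < j)%N} -> forall i, (i < k i)%N.
Proof.
by move=> k0 kP; elim=> [//|i IHi]; apply: leq_ltn_trans IHi (kP _ _ (ltnSn i)).
Qed.

Unset Implicit Arguments.

Theorem theorem4 (R : realType) (alpha beta : R) :
  feasible [set 1; -1] (alpha, beta) ->
  exists (k n : nat -> nat)
         (E : forall i, {linear 'rV[R]_(k i) -> 'rV[R]_(n i)}),
  forall A : set R, finite_set A ->
    exists (l : nat -> nat) (P : forall i, protocol A (k i) (n i) (l i)),
      (forall i, encoding (P i) = E i) /\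
      witnesses P (alpha, (complexity A)%:R * beta).
Proof.
move=> [k [n [l [P [k_homo cvP]]]]].
have ltk := homo_ltn_gt (k_gt0 (P 0%N)) k_homo.
exists k, (fun i => n i + 1)%N, (fun i => add_sum (encoding (P i))) => A finA.
have [_ decA _] := complexityP finA.
exists (fun i => complexity A * l i + 1)%N.
(* The family of protocols must be a function of [i], so [cid] picks a witness for each index. *)
pose Q i := cid (protocol_of_pm (P i) decA).
exists (fun i => sval (Q i)); split=> [i|]; first exact: svalP (Q i).
have cvn : (fun i => (n i)%:R / (k i)%:R : R) @ \oo --> alpha.
  exact: cvg_comp cvP cvg_fst.
have cvl : (fun i => (l i)%:R / (k i)%:R : R) @ \oo --> beta.
  exact: cvg_comp cvP cvg_snd.
(* With [t = 1] this covers the added server in [n i + 1]; [t = complexity A] then handles the query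
   sizes. *)
have := cvg_affine_ratio (t := 1%N) ltk cvn; rewrite mul1r.
under eq_fun do rewrite mul1n.
move=> cvn1; split=> //.
exact: cvg_pair cvn1 (cvg_affine_ratio (t := complexity A) ltk cvl).
Qed.
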